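(* Let $0<q<1$, $a,b,c,d,x\in\mathbb{C}$ generic, and $n\geq1$. For $0\le i\le n-1$ and $1\le j\le n$ let $$B_{i,j}=\frac{(ab;q)_{i+j-1}\,(-bq^{j-1})}{(abcd;q)_{i+j}}\Bigl[c+d-2x+(1-cd)(aq^{i}+bq^{j-1})-ab(c+d-2cdx)q^{i+j-1}\Bigr].$$ Then $$\det(B_{i,j})_{0\le i\le n-1,\,1\le j\le n}=D_n(a,b)\,p_n(x;a,b,c,d;q),$$ where $$D_n(a,b)=a^{n(n-1)/2}b^{n(n+1)/2}q^{n(n-1)(2n-1)/6}\prod_{i=0}^{n-1}\frac{(ab,cd,q;q)_i}{(abcd;q)_{n+i}}.$$
   Context: $(a;q)_n=\prod_{k=0}^{n-1}(1-aq^k)$ for $n\ge0$, and $(a_1,\dots,a_m;q)_n=\prod_i(a_i;q)_n$. The Askey–Wilson polynomials are, with $x=\cos\theta$ and $I^2=-1$, $p_n(x;a,b,c,d;q)=\frac{(ab,ac,ad;q)_n}{a^n}\sum_{k=0}^{n}\frac{(q^{-n},abcdq^{n-1},ae^{I\theta},ae^{-I\theta};q)_k}{(q,ab,ac,ad;q)_k}q^k,$ a polynomial of degree $n$ in $x$. *)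

(* Defs.v *)
From HB Require Import structures.
From mathcomp Require Import all_boot all_order all_algebra.
From mathcomp Require Import complex.
From mathcomp Require Import all_classical all_reals all_analysis.
From mathcomp Require Import ring.

Set Implicit Arguments.
Unset Strict Implicit.
Unset Printing Implicit Defensive.

Import Order.TTheory GRing.Theory Num.Theory.
Local Open Scope ring_scope.
Local Open Scope complex_scope.

Section ComplexTrig.
Variable R : realType.
Implicit Types z w x theta : R[i].

(* e^(u + I v) = e^u (cos v + I sin v) *)
Definition cexp z : R[i] :=
  (expR (complex.Re z))%:C * (cos (complex.Im z) +i* sin (complex.Im z)).

Definition ccos theta : R[i] :=
  (cexp ('i * theta) + cexp (- 'i * theta)) / 2.

Lemma cexpD z w : cexp (z + w) = cexp z * cexp w.
Proof.
case: z => a b; case: w => c d; rewrite /cexp /= expRD cosD sinD.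
by apply/eqP; rewrite eq_complex /=; apply/andP; split; apply/eqP; ring.
Qed.

Lemma cexp0 : cexp 0 = 1.
Proof.
rewrite /cexp /= expR0 cos0 sin0.
by apply/eqP; rewrite eq_complex /=; apply/andP; split; apply/eqP; ring.
Qed.

Lemma cexpNM z : cexp (- z) * cexp z = 1.
Proof. by rewrite -cexpD addNr cexp0. Qed.

Lemma cexp_surj z : z != 0 -> exists w, cexp w = z.
Proof.
case: z => a b nz.
pose r := Num.sqrt (a ^+ 2 + b ^+ 2).
have s_ge0 : 0 <= a ^+ 2 + b ^+ 2 by rewrite addr_ge0 ?sqr_ge0.
have r2 : r ^+ 2 = a ^+ 2 + b ^+ 2 by rewrite sqr_sqrtr.
have r_gt0 : 0 < r.
  rewrite sqrtr_gt0 lt_def s_ge0 andbT; apply: contraNneq nz => /eqP.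
  rewrite paddr_eq0 ?sqr_ge0 // !sqrf_eq0 => /andP[/eqP -> /eqP ->].
  by rewrite eq_complex /= !eqxx.
have r_neq0 : r != 0 by rewrite gt_eqF.
have uv1 : (a / r) ^+ 2 + (b / r) ^+ 2 = 1.
  by rewrite !expr_div_n -mulrDl -r2 divff // expf_neq0.
have u_itv : -1 <= a / r <= 1.
  by rewrite -ler_norml -(@expr_le1 _ 2) // real_normK ?num_real // -uv1
       lerDl sqr_ge0.
have sinE : sin (acos (a / r)) = `|b / r|.
  by rewrite sin_acos // -[1]uv1 addrAC subrr add0r sqrtr_sqr.
have [t ct st] : exists2 t, cos t = a / r & sin t = b / r.
  have [v_ge0|v_lt0] := leP 0 (b / r).
    by exists (acos (a / r)); rewrite ?acosK // sinE ger0_norm.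
  by exists (- acos (a / r)); rewrite ?cosN ?acosK // sinN sinE ltr0_norm ?opprK.
exists (ln r +i* t); rewrite /cexp /= lnK ?posrE // ct st.
apply/eqP; rewrite eq_complex /=.
by rewrite !mul0r subr0 addr0 ![r * _]mulrC !divfK // !eqxx.
Qed.

(* Hence "x = cos theta" for some theta is no restriction on the complex x. *)
Lemma ccos_surj x : exists theta, x = ccos theta.
Proof.
pose s := sqrtc (x ^+ 2 - 1).
have s2 : s ^+ 2 = x ^+ 2 - 1 by rewrite sqr_sqrtc.
have zM : (x - s) * (x + s) = 1 by rewrite -subr_sqr s2 opprB addrC subrK.
have z_neq0 : x + s != 0.
  by apply: contra_eq_neq zM => ->; rewrite mulr0 eq_sym oner_eq0.
have [w wE] := cexp_surj z_neq0.
exists (- 'i * w); rewrite /ccos.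
have i2 : 'i * 'i = -1 :> R[i] by rewrite -expr2 sqr_i.
have -> : 'i * (- 'i * w) = w by rewrite mulrA mulrN i2 opprK mul1r.
have -> : - 'i * (- 'i * w) = - w by rewrite mulrA mulrNN i2 mulN1r.
have -> : cexp (- w) = x - s.
  by apply: (mulIf z_neq0); rewrite zM -wE cexpNM.
rewrite wE addrACA subrr addr0 -mulr2n -[x *+ 2]mulr_natr mulfK //.
Qed.

End ComplexTrig.

Section AskeyWilson.
Variable R : realType.
Implicit Types a b c d q x theta : R[i].

(* (a; q)_n *)
Definition qpoch a q (n : nat) : R[i] := \prod_(k < n) (1 - a * q ^+ k).

(* (a_1, ..., a_m; q)_n *)
Definition qpochs (s : seq R[i]) q (n : nat) : R[i] :=
  \prod_(a <- s) qpoch a q n.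

(* p_n(cos theta; a, b, c, d; q) *)
Definition askey_wilson (n : nat) theta a b c d q : R[i] :=
  qpochs [:: a * b; a * c; a * d] q n / a ^+ n *
  \sum_(k < n.+1)
    qpochs [:: q ^- n; a * b * c * d * q ^+ (n - 1);
               a * cexp ('i * theta); a * cexp (- 'i * theta)] q k /
    qpochs [:: q; a * b; a * c; a * d] q k * q ^+ k.

(* Only used for 1 <= j, so the truncated subtractions are exact. *)
Definition AWentry x a b c d q (i j : nat) : R[i] :=
  qpoch (a * b) q (i + j - 1) * (- b * q ^+ (j - 1)) /
    qpoch (a * b * c * d) q (i + j) *
  (c + d - 2 * x + (1 - c * d) * (a * q ^+ i + b * q ^+ (j - 1))
   - a * b * (c + d - 2 * c * d * x) * q ^+ (i + j - 1)).

(* The three natural-number quotients in the exponents are exact. *)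
Definition AWconst (n : nat) a b c d q : R[i] :=
  a ^+ (n * (n - 1) %/ 2) * b ^+ (n * (n + 1) %/ 2) *
  q ^+ (n * (n - 1) * (2 * n - 1) %/ 6) *
  \prod_(i < n)
    (qpochs [:: a * b; c * d; q] q i / qpoch (a * b * c * d) q (n + i)).

End AskeyWilson.

(* Main.v *)
(* With z = e^(I theta) and h_r = (ab;q)_r / (abcd;q)_r the entries are
     B_(i,j) = - (b q^(j-1)) / (a q^i) * (h_(i+j-1) u_i - h_(i+j) v_i),
   where u_i = (1 - a z q^i) (1 - a q^i / z), v_i = (1 - a c q^i) (1 - a d q^i),
   so up to diagonal factors B is an n x (n+1) bidiagonal matrix times an
   (n+1) x n Hankel matrix.  Moreover h_(r+j) = g_r f_j(q^r) for polynomials f_j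
   of degree n - 1, so the maximal minors of the Hankel matrix are Vandermonde
   determinants times the determinant of the coefficients of the f_j.  Summing
   over the omitted row k, Cauchy-Binet yields the k-th terms of the sum that
   defines p_n. *)

Require Import Defs.
From HB Require Import structures.
From mathcomp Require Import all_boot all_order all_algebra.
From mathcomp Require Import complex.
From mathcomp Require Import all_classical all_reals all_analysis.
From mathcomp Require Import ring.

Set Implicit Arguments.
Unset Strict Implicit.
Unset Printing Implicit Defensive.

Import Order.TTheory GRing.Theory Num.Theory.
Local Open Scope ring_scope.
Local Open Scope complex_scope.

(** * Determinants of bidiagonal times Vandermonde matrices *)

Section BidiagonalDeterminants.
Variable F : fieldType.
Implicit Types (al be w : nat -> F).

(** Lagrange interpolation of ['X^j] at n + 1 nodes is exact for j <= n, and the Lagrange basis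
    polynomials are monic of degree n up to their weights; compare the coefficients of ['X^n]. *)
Lemma sum_divided_difference n (y : 'I_n.+1 -> F) j :
  injective y -> (j <= n)%N ->
  \sum_k y k ^+ j / \prod_(s | s != k) (y k - y s) = (j == n)%:R.
Proof.
move=> y_inj le_jn.
pose L k := \prod_(s | s != k) ('X - (y s)%:P).
have size_L k : size (L k) = n.+1.
  rewrite /L -big_filter size_prod_XsubC size_filter -sum1_count; congr _.+1.
  by rewrite (sum1_card (predC1 k)) cardC1 card_ord.
have coef_L k : (L k)`_n = 1.
  have /monicP : L k \is monic by apply: monic_prod_XsubC.
  by rewrite lead_coefE size_L.
have LE k x : (L k).[x] = \prod_(s | s != k) (x - y s).
  by rewrite horner_prod; apply: eq_bigr => s _; rewrite hornerXsubC.
pose c k := y k ^+ j / \prod_(s | s != k) (y k - y s).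
pose P := \sum_k c k *: L k - 'X^j.
have P0 : P = 0.
  apply: (@roots_geq_poly_eq0 _ _ (codom y)).
  - apply/allP => _ /codomP[i ->]; rewrite rootE /P hornerD hornerN hornerXn.
    rewrite horner_sum (bigD1 i) //= big1 => [|k k_i].
      rewrite hornerZ LE /c addr0 divfK ?subrr //.
      apply/prodf_neq0 => s s_i; rewrite subr_eq0.
      by apply: contraNneq s_i => /y_inj ->.
    by rewrite hornerZ LE (bigD1 i) 1?eq_sym //= subrr mul0r mulr0.
  - by rewrite map_inj_uniq // enum_uniq.
  rewrite size_codom card_ord (leq_trans (size_polyD _ _)) // geq_max.
  rewrite size_polyN size_polyXn ltnS le_jn andbT.
  apply: (leq_trans (size_sum _ _ _)); apply/bigmax_leqP => k _.
  by rewrite (leq_trans (size_scale_leq _ _)) // size_L.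
have := congr1 (fun p : {poly F} => p`_n) P0.
rewrite coefB coef0 coefXn eq_sym coef_sum => /eqP; rewrite subr_eq0 => /eqP <-.
by apply: eq_bigr => k _; rewrite coefZ coef_L mulr1.
Qed.

Lemma det_bidiagonal_last_row n al be w :
  \det (\matrix_(i < n.+1, j < n.+1)
    (if i == n :> nat then w j
     else al i *+ (j == i :> nat) + be i *+ (j == i.+1 :> nat))) =
  \sum_(k < n.+1) w k * (\prod_(i < k) al i) *
    \prod_(k <= i < n) (- be i).
Proof.
elim: n al be w => [|n IHn] al be w.
  by rewrite [LHS]det_mx11 mxE big_ord1 big_ord0 big_geq //= !mulr1.
rewrite (expand_det_col _ ord0) big_ord_recl big_ord_recr /= big1 => [|i _].
  rewrite !mxE /= eqxx /= mulr1n mulr0n addr0 add0r addrC.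
  rewrite [RHS]big_ord_recl big_ord0 mulr1; congr (_ + _).
    (* Without the first column and the last row the matrix is triangular with diagonal [be i]; the
       cofactor sign is absorbed as [- be i]. *)
    rewrite /cofactor addn0; congr (_ * _).
    rewrite det_trig; last first.
      apply/is_trig_mxP => i j lt_ij; rewrite !mxE !lift_max.
      by rewrite !lift0 ltn_eqF // eqSS !gtn_eqF ?addr0 // ltnS ltnW.
    rewrite big_mkord prodrN cardT size_enum_ord; congr (_ * _).
    apply: eq_bigr => i _; rewrite !mxE !lift_max !lift0 ltn_eqF //.
    by rewrite gtn_eqF // eqxx add0r.
  rewrite /cofactor expr0 mul1r.
  pose al' i := al i.+1; pose be' i := be i.+1; pose w' i := w i.+1.
  transitivity (al 0%N * \det (\matrix_(i < n.+1, j < n.+1)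
    (if i == n :> nat then w' j
     else al' i *+ (j == i :> nat) + be' i *+ (j == i.+1 :> nat)))).
    by congr (_ * \det _); apply/matrixP => i j; rewrite !mxE !lift0 !eqSS.
  rewrite IHn mulr_sumr; apply: eq_bigr => k _.
  by rewrite lift0 big_ord_recl big_add1 /= mulrA mulrCA.
by rewrite !mxE /= ltn_eqF ?mulr0n ?addr0 ?mul0r ?ltnS ?(ltn_ord i).
Qed.

Lemma det_Vandermonde_nat n (y : nat -> F) :
  \det (\matrix_(i < n, j < n) y i ^+ j) =
  \prod_(s < n) \prod_(r < s) (y s - y r).
Proof.
transitivity (\det (Vandermonde n (\row_(j < n) y j))^T).
  by congr (\det _); apply/matrixP => i j; rewrite !mxE.
rewrite det_tr det_Vandermonde (exchange_big_dep predT) //=.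
apply: eq_bigr => s _.
rewrite (big_ord_widen n (fun r => y s - y r)) ?(ltnW (ltn_ord s)) //.
by apply: eq_bigr => r _; rewrite !mxE.
Qed.

(* Completing the product of the bidiagonal and the Vandermonde factor by the
   row of divided-difference weights kills all but one entry of that row. *)
Lemma det_two_point_Vandermonde n (y : nat -> F) al be :
  {in [pred i | (i <= n)%N] &, injective y} ->
  \det (\matrix_(i < n, j < n) (al i * y i ^+ j + be i * y i.+1 ^+ j)) =
  (\prod_(s < n.+1) \prod_(r < s) (y s - y r)) *
  \sum_(k < n.+1) (\prod_(i < k) al i) * (\prod_(k <= i < n) - be i) /
    \prod_(s < n.+1 | s != k) (y k - y s).
Proof.
move=> y_inj.
have y_inj' : injective (fun i : 'I_n.+1 => y i).
  by move=> i j eq_y; apply/val_inj/y_inj; rewrite ?inE ?leq_ord.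
pose w k := (\prod_(s < n.+1 | s != k :> nat) (y k - y s))^-1.
pose V := \matrix_(i < n.+1, j < n.+1) y i ^+ j.
pose K := \matrix_(i < n.+1, j < n.+1) (if i == n :> nat then w j
     else al i *+ (j == i :> nat) + be i *+ (j == i.+1 :> nat)).
transitivity (\det V * \det K); last first.
  rewrite det_Vandermonde_nat det_bidiagonal_last_row; congr (_ * _).
  by apply: eq_bigr => k _; rewrite -mulrA mulrC.
rewrite mulrC -det_mulmx (expand_det_row _ ord_max) (bigD1 ord_max) //=.
have KVE j : (K *m V) ord_max j = (j == ord_max)%:R.
  rewrite -[RHS](sum_divided_difference y_inj' (leq_ord j)) mxE.
  by apply: eq_bigr => k _; rewrite !mxE eqxx mulrC.
rewrite big1 ?addr0 => [|j /negPf j_n]; last by rewrite KVE j_n mul0r.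
rewrite KVE eqxx mul1r /cofactor addnn -signr_odd odd_double mul1r.
congr (\det _); apply/matrixP => i j; rewrite !mxE.
have lt_i : (i < n.+1)%N by rewrite ltnS ltnW ?ltn_ord.
have lt_i' : (i.+1 < n.+1)%N by rewrite ltnS ltn_ord.
rewrite (bigD1 (Ordinal lt_i)) // (bigD1 (Ordinal lt_i')) /=; last first.
  by rewrite -val_eqE /= gtn_eqF.
rewrite big1 ?addr0 => [|k /andP[]]; last first.
  rewrite -!val_eqE /= => /negPf k_i /negPf k_i'.
  by rewrite !mxE lift_max ltn_eqF // k_i k_i' addr0 mul0r.
rewrite !mxE !lift_max ltn_eqF ?ltn_ord // !eqxx /= ltn_eqF // gtn_eqF //.
by rewrite !mulr0n addr0 add0r.
Qed.

Lemma horner_matrix m n (y : 'I_m -> F) (f : 'I_n -> {poly F}) :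
  (forall j, size (f j) <= n)%N ->
  \matrix_(i < m, j < n) (f j).[y i] =
  (\matrix_(i < m, k < n) y i ^+ k) *m (\matrix_(k < n, j < n) (f j)`_k).
Proof.
move=> size_f; apply/matrixP => i j; rewrite !mxE (horner_coef_wide _ (size_f j)).
by apply: eq_bigr => k _; rewrite !mxE mulrC.
Qed.

(** Polynomials of degree below n have values that factor through the monomials, so the coefficient
    matrix splits off on the right of the two-point Vandermonde matrix. *)
Lemma det_two_point n (y : nat -> F) al be (f : 'I_n -> {poly F}) :
  {in [pred i | (i <= n)%N] &, injective y} ->
  (forall j, size (f j) <= n)%N ->
  \det (\matrix_(i < n, j < n)
    (al i * (f j).[y i] + be i * (f j).[y i.+1])) =
  (\prod_(s < n.+1) \prod_(r < s) (y s - y r)) *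
  (\sum_(k < n.+1) (\prod_(i < k) al i) * (\prod_(k <= i < n) - be i) /
    \prod_(s < n.+1 | s != k) (y k - y s)) *
  \det (\matrix_(k < n, j < n) (f j)`_k).
Proof.
move=> y_inj size_f; rewrite -det_two_point_Vandermonde // -det_mulmx.
congr (\det _); apply/matrixP => i j; rewrite !mxE.
rewrite !(horner_coef_wide _ (size_f j)) !mulr_sumr -big_split /=.
by apply: eq_bigr => k _; rewrite !mxE; ring.
Qed.

Lemma det_scale_rows_cols n (r c : 'I_n -> F) (A : 'M[F]_n) :
  \det (\matrix_(i, j) (r i * c j * A i j)) =
  (\prod_i r i) * (\prod_j c j) * \det A.
Proof.
have -> : \matrix_(i, j) (r i * c j * A i j) =
    diag_mx (\row_i r i) *m A *m diag_mx (\row_j c j).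
  apply/matrixP => i j; rewrite mul_mx_diag mul_diag_mx !mxE.
  by rewrite mulrAC.
rewrite !det_mulmx !det_diag mulrAC.
by congr (_ * _ * _); apply: eq_bigr => i _; rewrite mxE.
Qed.

End BidiagonalDeterminants.

(** * Shifted factorials: divided-difference weights at powers of q, and the polynomials f_j *)

Section QPochhammer.
Variable R : realType.
Implicit Types a b c d e t q z : R[i].

Lemma qpochSr a q n : qpoch a q n.+1 = qpoch a q n * (1 - a * q ^+ n).
Proof. exact: big_ord_recr. Qed.

Lemma qpochD a q m n : qpoch a q (m + n) = qpoch a q m * qpoch (a * q ^+ m) q n.
Proof.
rewrite /qpoch big_split_ord; congr (_ * _).
by apply: eq_bigr => k _; rewrite /= exprD mulrA.
Qed.

Lemma qpoch_neq0_leq a q m n : (m <= n)%N -> qpoch a q n != 0 -> qpoch a q m != 0.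
Proof. by move/subnKC <-; rewrite qpochD mulf_eq0 negb_or => /andP[]. Qed.

Lemma qpoch_neq0 q n : (forall k, q ^+ k.+1 != 1) -> qpoch q q n != 0.
Proof.
move=> q_gen; apply/prodf_neq0 => k _.
by rewrite -exprS subr_eq0 eq_sym.
Qed.

Lemma qpoch_range a q k n : (k <= n)%N ->
  qpoch a q k * \prod_(k <= i < n) (1 - a * q ^+ i) = qpoch a q n.
Proof.
move=> le_kn; rewrite /qpoch -!(big_mkord xpredT (fun i => 1 - a * q ^+ i)).
by rewrite -big_cat_nat.
Qed.

(** Factor by factor, after reversing the order: (1 - q^-N) (-q^N) = 1 - q^N with N = m + r + 1. *)
Lemma qpoch_neg_exp q m k : q != 0 ->
  qpoch (q ^- (k + m)) q k * \prod_(r < k) - q ^+ (m + r.+1) =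
  qpoch (q ^+ m.+1) q k.
Proof.
move=> q0; rewrite /qpoch (reindex_inj rev_ord_inj) -big_split /=.
apply: eq_bigr => r _; rewrite -exprD addSn -addnS.
have -> : q ^- (k + m) * q ^+ (k - r.+1) = q ^- (m + r.+1).
  apply: (canLR (mulKf _)); rewrite ?expf_neq0 //.
  rewrite -[in q ^+ (k + m)](subnK (ltn_ord r)) -addnA [(r.+1 + m)%N]addnC exprD.
  by rewrite mulfK ?expf_neq0.
by rewrite mulrBl mul1r mulrN mulVf ?expf_neq0 // opprK addrC.
Qed.

Lemma prod_subX q s :
  \prod_(r < s) (q ^+ s - q ^+ r) = (\prod_(r < s) - q ^+ r) * qpoch q q s.
Proof.
rewrite /qpoch [X in _ * X](reindex_inj rev_ord_inj) -big_split /=.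
apply: eq_bigr => r _; rewrite -exprS -subSn // subSS mulrBr mulr1 mulNr -exprD.
by rewrite subnKC ?(ltnW (ltn_ord r)) // opprK addrC.
Qed.

(** At the nodes q^s the weights already produce the factor (q^-n;q)_k q^k / (q;q)_k of the
    Askey-Wilson sum. *)
Lemma divided_difference_weight_powers q n k :
  q != 0 -> (forall i, q ^+ i.+1 != 1) -> (k <= n)%N ->
  (\prod_(s < n.+1 | s != k :> nat) (q ^+ k - q ^+ s))^-1 =
  qpoch (q ^- n) q k * q ^+ k / (qpoch q q k * qpoch q q n).
Proof.
move=> q0 q_gen /subnKC; move: (n - k)%N => m <-.
have -> : \prod_(s < (k + m).+1 | s != k :> nat) (q ^+ k - q ^+ s) =
    (\prod_(r < k) - q ^+ r) * qpoch q q k * (q ^+ (k * m) * qpoch q q m).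
  rewrite -(big_mkord (fun s => s != k) (fun s => q ^+ k - q ^+ s)).
  (* Nodes below k give [prod_subX]; a node s = k + 1 + i above k gives q^k (1 - q^(i+1)). *)
  rewrite (@big_cat_nat _ _ _ k) ?leqW ?leq_addr //=; congr (_ * _).
    rewrite -prod_subX -(big_mkord xpredT (fun r => q ^+ k - q ^+ r)).
    rewrite big_nat_cond [RHS]big_nat_cond; apply: eq_bigl => s.
    by case: (ltngtP s k); rewrite ?andbF.
  rewrite big_ltn_cond ?ltnS ?leq_addr // eqxx /=.
  rewrite -addSn [(k.+1 + m)%N]addnC -{1}[k.+1]add0n big_addn addnK big_mkord.
  rewrite exprM /qpoch -[m in X in X * _]card_ord -prodr_const.
  rewrite [X in X * _](eq_bigl xpredT) // -big_split /=.
  rewrite big_mkcond /=; apply: eq_bigr => i _.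
  rewrite gtn_eqF ?leq_addl //= mulrBr mulr1 -exprS -exprD.
  by rewrite addnC addSnnS.
have qk : qpoch (q ^- (k + m)) q k * q ^+ k * ((\prod_(r < k) - q ^+ r) *
    (q ^+ (k * m) * qpoch q q m)) = qpoch q q (k + m).
  rewrite [in RHS]addnC qpochD -exprS -qpoch_neg_exp //.
  have -> : \prod_(r < k) - q ^+ (m + r.+1) =
      q ^+ k * q ^+ (k * m) * \prod_(r < k) - q ^+ r.
    rewrite -exprD -mulnS mulnC exprM.
    have <- : \prod_(r < k) q ^+ m.+1 = q ^+ m.+1 ^+ k.
      by rewrite prodr_const card_ord.
    rewrite -big_split /=; apply: eq_bigr => r _.
    by rewrite mulrN -exprD addSnnS.
  by ring.
have P0 : \prod_(r < k) - q ^+ r != 0.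
  by apply/prodf_neq0 => r _; rewrite oppr_eq0 expf_neq0.
apply: (@mulfI _ (qpoch q q k * qpoch q q (k + m))).
  by rewrite mulf_neq0 ?qpoch_neq0.
rewrite [RHS]mulrCA mulfV ?mulr1 ?mulf_neq0 ?qpoch_neq0 //.
rewrite -qk; field.
by rewrite P0 expf_neq0 ?q0 ?qpoch_neq0.
Qed.

Definition qpoly e q n : {poly R[i]} := \prod_(k < n) (1 - (e * q ^+ k) *: 'X).

Lemma horner_qpoly e q n y : (qpoly e q n).[y] = qpoch (e * y) q n.
Proof.
rewrite horner_prod; apply: eq_bigr => k _.
by rewrite hornerD hornerN hornerZ hornerX hornerC mulrAC.
Qed.

Lemma size_qpoly e q n : (size (qpoly e q n) <= n.+1)%N.
Proof.
elim: n => [|n IHn]; first by rewrite /qpoly big_ord0 size_poly1.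
rewrite /qpoly big_ord_recr /=; apply: (leq_trans (size_polyMleq _ _)).
have : (size (1 - (e * q ^+ n) *: 'X : {poly R[i]})%R <= 2)%N.
  rewrite (leq_trans (size_polyD _ _)) // geq_max size_poly1 size_polyN.
  by rewrite (leq_trans (size_scale_leq _ _)) ?size_polyX.
by move=> szX; have := leq_add IHn szX; rewrite addn2; case: (_ + _)%N.
Qed.

(** The polynomial f_j, used with e = ab, t = cd and m = n - 1. The second factor completes the
    denominator (et;q)_(r+j) to (et;q)_(r+m), which is free of j; the degree is at most m for every
    j <= m. *)
Definition moment_poly e t q m (j : nat) : {poly R[i]} :=
  qpoly e q j * qpoly (e * t * q ^+ j) q (m - j).

Lemma size_moment_poly e t q m (j : 'I_m.+1) :
  (size (moment_poly e t q m j) <= m.+1)%N.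
Proof.
apply: (leq_trans (size_polyMleq _ _)).
have := leq_add (size_qpoly e q j) (size_qpoly (e * t * q ^+ j) q (m - j)).
by rewrite addSn addnS subnKC ?leq_ord //; case: (_ + _)%N.
Qed.

Lemma qpoch_ratio e t q m r j : (j <= m)%N ->
  qpoch (e * t) q (r + m) != 0 ->
  qpoch e q (r + j) / qpoch (e * t) q (r + j) =
  qpoch e q r / qpoch (e * t) q (r + m) * (moment_poly e t q m j).[q ^+ r].
Proof.
move=> le_jm; have -> : qpoch (e * t) q (r + m) =
    qpoch (e * t) q (r + j) * qpoch (e * t * q ^+ (r + j)) q (m - j).
  by rewrite -qpochD -addnA subnKC.
rewrite mulf_eq0 negb_or => /andP[nz1 nz2].
rewrite hornerM !horner_qpoly qpochD -[_ * q ^+ j * q ^+ r]mulrA -exprD.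
by rewrite [(j + r)%N]addnC; field; rewrite ?nz1 ?nz2.
Qed.

(* At the points [q^-r / e] the matrix of values is triangular. *)
Lemma det_coef_moment_poly e t q m :
  q != 0 -> (forall i, q ^+ i.+1 != 1) -> e != 0 ->
  \det (\matrix_(k < m.+1, j < m.+1) (moment_poly e t q m j)`_k) =
  \prod_(s < m.+1) ((\prod_(r < s) - (e * q ^+ r)) * qpoch t q s).
Proof.
move=> q0 q_gen e0; pose y r := q ^- r / e.
set C := \matrix_(k, j) _.
pose V := \matrix_(i < m.+1, j < m.+1) y i ^+ j.
(* Each pair of factors multiplies to 1 - q^(r-s), so row s of the Vandermonde product times the
   claimed monomials is a factor of the s-th diagonal value. *)
have VE s : (\prod_(r < s) (y s - y r)) * (\prod_(r < s) - (e * q ^+ r)) =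
    qpoch (q ^- s) q s.
  rewrite -big_split; apply: eq_bigr => r _ /=.
  by rewrite /y; field; rewrite e0 !expf_neq0.
have V0 s : \prod_(r < s) (y s - y r) != 0.
  suff : qpoch (q ^- s) q s != 0 by rewrite -VE mulf_eq0 negb_or => /andP[].
  have := qpoch_neg_exp 0 s q0; rewrite addn0 expr1 => qs.
  by move: (qpoch_neq0 s q_gen); rewrite -qs mulf_eq0 negb_or => /andP[].
apply: (@mulfI _ (\det V)).
  by rewrite det_Vandermonde_nat; apply/prodf_neq0 => s _; apply: V0.
rewrite -det_mulmx {1}/V /C -horner_matrix; last exact: size_moment_poly.
have hE (i j : nat) : (moment_poly e t q m j).[y i] =
    qpoch (q ^- i) q j * qpoch (t * q ^+ j / q ^+ i) q (m - j).
  rewrite hornerM !horner_qpoly /y; congr (qpoch _ _ _ * qpoch _ _ _);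
    by field; rewrite e0 expf_neq0.
rewrite det_trig; last first.
  (* For i < j the product (q^-i;q)_j contains the factor 1 - q^-i q^i = 0. *)
  apply/is_trig_mxP => i j lt_ij; rewrite mxE hE /qpoch.
  by rewrite (bigD1 (Ordinal lt_ij)) //= mulVf ?expf_neq0 // subrr !mul0r.
rewrite det_Vandermonde_nat big_split /= mulrA -big_split /=.
(* The s-th diagonal value carries (t;q)_(m-s), hence the reversal. *)
rewrite [X in _ = _ * X](reindex_inj rev_ord_inj) -big_split /=.
by apply: eq_bigr => s _; rewrite mxE hE mulfK ?expf_neq0 // VE subSS.
Qed.

End QPochhammer.

(** * The identity that splits an entry, and products with one index omitted *)

Section Entries.
Variable F : fieldType.
Implicit Types (a b c d x z : F) (g : nat -> F).

(** Applied with A = a q^i and B = b q^(j-1): then 1 - ABcd and 1 - AB are the last factors of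
    (abcd;q)_(i+j) and (ab;q)_(i+j), so the two terms become consecutive values of h. *)
Lemma AW_bracketE A B c d x z :
  A != 0 -> z != 0 -> 2 * x = z + z^-1 ->
  A * (c + d - 2 * x + (1 - c * d) * (A + B) - A * B * (c + d - 2 * c * d * x)) =
  (1 - A * B * c * d) * ((1 - A * z) * (1 - A / z))
  - (1 - A * B) * ((1 - A * c) * (1 - A * d)).
Proof.
move=> A0 z0 xE; have -> : 2 * c * d * x = c * d * (2 * x) by ring.
by rewrite xE; field.
Qed.

(** In the k-th term the rows i < k contribute [g i] and the rows i >= k contribute [g i.+1], which
    leaves out exactly the index k. *)
Lemma prod_skip g k n : (k <= n)%N ->
  (\prod_(i < k) g i) * (\prod_(k <= i < n) g i.+1) * g k =
  \prod_(i < n.+1) g i.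
Proof.
move=> le_kn; rewrite -!(big_mkord xpredT g) [RHS](@big_cat_nat _ _ _ k) ?leqW //=.
by rewrite [X in _ = _ * X]big_ltn ?ltnS // big_add1 /= mulrA mulrAC.
Qed.

End Entries.

(** * Evaluation of the constant D_n *)

Lemma sum_exponents n :
  (n * (n - 1) %/ 2 = \sum_(i < n) i)%N /\
  (n * (n - 1) * (2 * n - 1) %/ 6 = \sum_(i < n) i ^ 2)%N.
Proof.
have E2 : (n * (n - 1) = (\sum_(i < n) i) * 2)%N.
  elim: n => [|n IHn]; first by rewrite big_ord0.
  rewrite big_ord_recr /= mulnDl -IHn subn1 /= mulnC -mulnDr.
  by case: n {IHn} => // n; rewrite subn1 addn2.
have E6 : (n * (n - 1) * (2 * n - 1) = (\sum_(i < n) i ^ 2) * 6)%N.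
  elim: n {E2} => [|n IHn]; first by rewrite big_ord0.
  rewrite big_ord_recr /= mulnDl -IHn.
  (* For n = 0 both sides vanish; for a successor the truncated subtractions are exact. *)
  case: n {IHn} => // n.
  have -> : (2 * n.+2 - 1 = 2 * n + 3)%N by rewrite !mulnS !addnA subn1 /=; ring.
  have -> : (2 * n.+1 - 1 = 2 * n + 1)%N by rewrite !mulnS subn1 /=; ring.
  by rewrite !subn1 -mulnn /=; ring.
by rewrite E6 E2 !mulnK.
Qed.

Section Constant.
Variable R : realType.
Implicit Types a b c d q : R[i].

Lemma AWconstE n a b c d q :
  AWconst n a b c d q =
  \prod_(s < n) (a ^+ s * b ^+ s.+1 * q ^+ (s ^ 2) *
    (qpoch (a * b) q s * qpoch (c * d) q s * qpoch q q s
     / qpoch (a * b * c * d) q (n + s))).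
Proof.
have [E2 E6] := sum_exponents n.
have E2' : (n * (n + 1) %/ 2 = \sum_(i < n) i.+1)%N.
  (* The exponent of b is the triangular exponent of a taken at n + 1. *)
  have [+ _] := sum_exponents n.+1; rewrite subn1 addn1 mulnC /= => ->.
  by rewrite big_ord_recl.
rewrite /AWconst E2 E2' E6 -!prodrXr -!big_split /=; apply: eq_bigr => s _.
by rewrite /qpochs !big_cons big_nil mulr1 !mulrA.
Qed.

(** The 2s signs cancel, and the exponent of q is 2 (0 + ... + (s - 1)) + s = s^2. *)
Lemma prod_neg_geometric_sqr e q s :
  (\prod_(r < s) - q ^+ r) * (\prod_(r < s) - (e * q ^+ r)) * q ^+ s =
  e ^+ s * q ^+ (s ^ 2).
Proof.
elim: s => [|s IHs]; first by rewrite !big_ord0 !mulr1.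
have -> : (s.+1 ^ 2 = s ^ 2 + s + s.+1)%N by rewrite -!mulnn; ring.
rewrite !big_ord_recr /= [q ^+ (_ + _ + _)]exprD [q ^+ (_ + s)]exprD.
transitivity (e * q ^+ s * q ^+ s.+1 * ((\prod_(r < s) - q ^+ r) *
  (\prod_(r < s) - (e * q ^+ r)) * q ^+ s)); first by ring.
by rewrite IHs [e ^+ s.+1]exprS; ring.
Qed.

(** Passing from n to n + 1 adds one row to each double product; the sign of the new -b cancels that
    of the extra -q^n, and [prod_neg_geometric_sqr] with e = ab evaluates the rest. *)
Lemma prod_neg_geometric n a b q :
  (- b) ^+ n * (\prod_(s < n.+1) \prod_(r < s) - q ^+ r) *
  (\prod_(s < n) \prod_(r < s) - (a * b * q ^+ r)) =
  \prod_(s < n) (a ^+ s * b ^+ s.+1 * q ^+ (s ^ 2)).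
Proof.
elim: n => [|n IHn]; first by rewrite big_ord1 !big_ord0 !mulr1.
rewrite [RHS]big_ord_recr /= -IHn.
have := prod_neg_geometric_sqr (a * b) q n; rewrite exprMn => E.
rewrite [X in _ * X * _ = _]big_ord_recr /= [\prod_(r < n.+1) - _]big_ord_recr /=.
rewrite [X in _ * X = _]big_ord_recr /=.
transitivity ((- b) ^+ n * (\prod_(s < n.+1) \prod_(r < s) - q ^+ r) *
  (\prod_(s < n) \prod_(r < s) - (a * b * q ^+ r)) *
  (b * ((\prod_(r < n) - q ^+ r) * (\prod_(r < n) - (a * b * q ^+ r)) * q ^+ n))).
  by rewrite exprS; ring.
by rewrite E exprS; ring.
Qed.

(** Collects what the determinant contributes independently of k: scalings, Vandermonde product,
    coefficient determinant, all g_r, and the k-free parts of 1 / g_k and of the weights. *)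
Lemma AWconst_factor m a b c d q :
  let n := m.+1 in
  (forall i, q ^+ i.+1 != 1) ->
  qpoch (a * b * c * d) q (2 * n - 1) != 0 ->
  (- b) ^+ n * (\prod_(s < n.+1) \prod_(r < s) (q ^+ s - q ^+ r)) *
  (\prod_(s < n) ((\prod_(r < s) - (a * b * q ^+ r)) * qpoch (c * d) q s)) *
  (\prod_(r < n.+1) (qpoch (a * b) q r / qpoch (a * b * c * d) q (r + m))) *
  (qpoch (a * b * c * d) q m / qpoch q q n) =
  AWconst n a b c d q * qpoch (a * b) q n.
Proof.
move=> n q_gen s_nz.
have sm_nz : qpoch (a * b * c * d) q m != 0.
  apply: qpoch_neq0_leq s_nz.
  by rewrite mul2n -addnn -addnBA // subn1 addSn leqW ?leq_addr.
have q_nz : qpoch q q n != 0 by apply: qpoch_neq0.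
(* The numerators lose their last factor r = n and the denominators their first, r = 0; as n = m +
   1, the remaining denominators have index n + r. *)
have GE : \prod_(r < n.+1) (qpoch (a * b) q r / qpoch (a * b * c * d) q (r + m))
    = qpoch (a * b) q n / qpoch (a * b * c * d) q m *
      \prod_(r < n) (qpoch (a * b) q r / qpoch (a * b * c * d) q (n + r)).
  rewrite !big_split /= [in LHS]big_ord_recr /=.
  have -> : \prod_(r < n.+1) (qpoch (a * b * c * d) q (r + m))^-1 =
      (qpoch (a * b * c * d) q m)^-1 *
      \prod_(r < n) (qpoch (a * b * c * d) q (n + r))^-1.
    rewrite big_ord_recl; congr (_ * _).
    by apply: eq_bigr => i _; rewrite lift0 addSnnS addnC.
  by ring.
have VE : \prod_(s < n.+1) \prod_(r < s) (q ^+ s - q ^+ r) =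
    (\prod_(s < n.+1) \prod_(r < s) - q ^+ r) *
    ((\prod_(s < n) qpoch q q s) * qpoch q q n).
  rewrite -(big_ord_recr n (qpoch q q)) -big_split /=.
  by apply: eq_bigr => s _; rewrite prod_subX.
rewrite AWconstE GE VE [\prod_(s < n) (_ * qpoch (c * d) q _)]big_split /=.
rewrite [RHS](_ : _ = (- b) ^+ n * (\prod_(s < n.+1) \prod_(r < s) - q ^+ r) *
  (\prod_(s < n) \prod_(r < s) - (a * b * q ^+ r)) *
  (\prod_(s < n) qpoch (c * d) q s) * (\prod_(s < n) qpoch q q s) *
  (\prod_(s < n) (qpoch (a * b) q s / qpoch (a * b * c * d) q (n + s))) *
  qpoch (a * b) q n); last first.
  congr (_ * _); rewrite prod_neg_geometric -!big_split /=.
  by apply: eq_bigr => s _; ring.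
by field; rewrite sm_nz q_nz.
Qed.

End Constant.

(** * Assembling the determinant *)

Section Main.
Variable R : realType.
Implicit Types a b c d q x z : R[i].

Lemma AWentryE a b c d x z q i j :
  a != 0 -> z != 0 -> q != 0 -> 2 * x = z + z^-1 ->
  qpoch (a * b * c * d) q (i + j).+1 != 0 ->
  AWentry x a b c d q i j.+1 =
  (a * q ^+ i)^-1 * - (b * q ^+ j) *
  (qpoch (a * b) q (i + j) / qpoch (a * b * c * d) q (i + j) *
     ((1 - a * z * q ^+ i) * (1 - a / z * q ^+ i))
   - qpoch (a * b) q (i + j).+1 / qpoch (a * b * c * d) q (i + j).+1 *
     ((1 - a * c * q ^+ i) * (1 - a * d * q ^+ i))).
Proof.
move=> a0 z0 q0 xE; rewrite /AWentry addnS !subn1 /= !qpochSr mulf_eq0 negb_or.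
move=> /andP[nz1 nz2]; have A0 : a * q ^+ i != 0 by rewrite mulf_neq0 ?expf_neq0.
have BE := AW_bracketE (b * q ^+ j) c d A0 z0 xE.
have -> : a * b * (c + d - 2 * c * d * x) * q ^+ (i + j) =
    a * q ^+ i * (b * q ^+ j) * (c + d - 2 * c * d * x) by rewrite exprD; ring.
set br := c + d - _ + _ - _ in BE *.
have -> : br = (a * q ^+ i)^-1 * (a * q ^+ i * br) by rewrite mulKf.
rewrite {}BE !exprD; move: nz2; rewrite exprD => nz2.
by field; rewrite ?nz1 ?nz2 ?z0 ?a0 ?expf_neq0.
Qed.

Lemma exprn_inj q :
  q != 0 -> (forall i, q ^+ i.+1 != 1) -> injective (fun i => q ^+ i).
Proof.
move=> q0 q_gen i j; wlog le_ij : i j / (i <= j)%N => [wlog_ij|].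
  by case/orP: (leq_total i j) => /wlog_ij // + /esym => /[apply] ->.
rewrite -(subnKC le_ij) exprD -[LHS]mulr1 => /(mulfI (expf_neq0 _ q0)).
case: (j - i)%N => [|k]; first by rewrite addn0.
by move/eqP; rewrite eq_sym (negPf (q_gen k)).
Qed.

(** Here z stands for e^(I theta). The assumption on b makes ab nonzero, as the evaluation of the
    coefficient determinant at the points q^-r / (ab) demands. *)
Lemma det_AWentry m a b c d x z q :
  let n := m.+1 in
  a != 0 -> b != 0 -> z != 0 -> q != 0 -> (forall i, q ^+ i.+1 != 1) ->
  2 * x = z + z^-1 ->
  qpoch (a * b) q n != 0 -> qpoch (a * c) q n != 0 -> qpoch (a * d) q n != 0 ->
  qpoch (a * b * c * d) q (2 * n - 1) != 0 ->
  \det (\matrix_(i < n, j < n) AWentry x a b c d q i j.+1) =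
  AWconst n a b c d q *
  (qpoch (a * b) q n * qpoch (a * c) q n * qpoch (a * d) q n / a ^+ n *
  \sum_(k < n.+1)
    (qpoch (q ^- n) q k * qpoch (a * b * c * d * q ^+ m) q k *
     qpoch (a * z) q k * qpoch (a / z) q k) /
    (qpoch q q k * qpoch (a * b) q k * qpoch (a * c) q k * qpoch (a * d) q k) *
    q ^+ k).
Proof.
move=> n a0 b0 z0 q0 q_gen xE ab_nz ac_nz ad_nz s_nz.
have n2 : (2 * n - 1 = n + m)%N by rewrite mul2n -addnn -addnBA // subn1.
have s_nz' i : (i <= n + m)%N -> qpoch (a * b * c * d) q i != 0.
  by move=> le_i; apply: qpoch_neq0_leq s_nz; rewrite n2.
have sE : a * b * c * d = a * b * (c * d) by rewrite !mulrA.
pose u i := (1 - a * z * q ^+ i) * (1 - a / z * q ^+ i).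
pose v i := (1 - a * c * q ^+ i) * (1 - a * d * q ^+ i).
pose g r := qpoch (a * b) q r / qpoch (a * b * c * d) q (r + m).
pose f (j : 'I_n) := moment_poly (a * b) (c * d) q m j.
have q_inj : {in [pred i | (i <= n)%N] &, injective (fun i => q ^+ i)}.
  by move=> i j _ _; apply: exprn_inj.
transitivity (\det (\matrix_(i < n, j < n) ((a * q ^+ i)^-1 * - (b * q ^+ j) *
  (\matrix_(i < n, j < n) (u i * g i * (f j).[q ^+ i]
    + (- (v i * g i.+1)) * (f j).[q ^+ i.+1])) i j))).
  congr (\det _); apply/matrixP => i j; rewrite !mxE.
  rewrite (@AWentryE a b c d x z q) //; last first.
    by apply: s_nz'; rewrite -addSn leq_add ?leq_ord // ltn_ord.
  have gE r : (r <= n)%N -> qpoch (a * b) q (r + j) /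
      qpoch (a * b * c * d) q (r + j) = g r * (f j).[q ^+ r].
    move=> le_rn; rewrite /g /f sE; apply: qpoch_ratio; first exact: leq_ord.
    by rewrite -sE s_nz' ?leq_add2r.
  by rewrite -addSn !gE ?ltn_ord 1?ltnW ?ltn_ord // /u /v; ring.
rewrite det_scale_rows_cols (@det_two_point _ _ (fun i => q ^+ i)
  (fun i => u i * g i) (fun i => - (v i * g i.+1))) //; last first.
  exact: size_moment_poly.
rewrite det_coef_moment_poly ?mulf_neq0 //.
(* The powers of q in the row and column scalings cancel. *)
have -> : (\prod_(i < n) (a * q ^+ i)^-1) * (\prod_(j < n) - (b * q ^+ j)) =
    (- b) ^+ n / a ^+ n.
  rewrite -big_split (eq_bigr (fun=> - b / a)) => [|i _] /=.
    by rewrite prodr_const card_ord expr_div_n.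
  by field; rewrite a0 expf_neq0.
set S := \sum_(k < n.+1) _ / _ * _.
transitivity ((- b) ^+ n / a ^+ n *
  ((\prod_(s < n.+1) \prod_(r < s) (q ^+ s - q ^+ r)) *
   ((\prod_(r < n.+1) g r) * (qpoch (a * b * c * d) q m / qpoch q q n) *
     (qpoch (a * c) q n * qpoch (a * d) q n) * S) *
   (\prod_(s < n) ((\prod_(r < s) - (a * b * q ^+ r)) * qpoch (c * d) q s)))).
  congr (_ * (_ * _ * _)); rewrite mulr_sumr; apply: eq_bigr => k _.
  have le_kn : (k <= n)%N := leq_ord k.
  rewrite (divided_difference_weight_powers q0 q_gen le_kn).
  have gk_nz : g k != 0.
    by rewrite mulf_neq0 ?invr_eq0 ?s_nz' ?leq_add2r ?(qpoch_neq0_leq _ ab_nz).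
  rewrite -(prod_skip g le_kn).
  (* The product of v_i over k <= i < n is (ac,ad;q)_n / (ac,ad;q)_k. *)
  rewrite -(qpoch_range (a * c) q le_kn) -(qpoch_range (a * d) q le_kn).
  rewrite big_split /= [\prod_(i < k) u i]big_split /=.
  rewrite (eq_bigr (fun i => v i * g i.+1)) => [|i _]; last by rewrite opprK.
  rewrite /v.
  rewrite !big_split /=.
  have ack : qpoch (a * c) q k != 0 by apply: qpoch_neq0_leq ac_nz.
  have adk : qpoch (a * d) q k != 0 by apply: qpoch_neq0_leq ad_nz.
  have abk : qpoch (a * b) q k != 0 by apply: qpoch_neq0_leq ab_nz.
  have skm : qpoch (a * b * c * d) q (k + m) != 0 by rewrite s_nz' ?leq_add2r.
  (* The omitted g_k is the source of the parameter abcd q^(n-1): 1 / g_k = (abcd;q)_m (abcd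
     q^m;q)_k / (ab;q)_k. *)
  have gE : qpoch (a * b * c * d) q m * qpoch (a * b * c * d * q ^+ m) q k
      * g k = qpoch (a * b) q k.
    by rewrite -qpochD addnC /g mulrC divfK.
  rewrite -/(qpoch (a * z) q k) -/(qpoch (a / z) q k) -gE.
  have qk : qpoch q q k != 0 by apply: qpoch_neq0.
  have qn : qpoch q q n != 0 by apply: qpoch_neq0.
  move: skm; rewrite addnC qpochD mulf_eq0 negb_or => /andP[sm smk].
  field.
  by rewrite ?qk ?qn ?sm ?smk ?ack ?adk ?gk_nz.
have E : (- b) ^+ n * _ * _ * _ * _ = _ := AWconst_factor q_gen s_nz.
rewrite !mulrA -E /g; ring.
Qed.

End Main.

(* The hypotheses Ha, Hp and Hs are the genericity of the parameters: they say
   exactly that no denominator in the two sides vanishes.  The column index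
   j : 'I_n runs from 0, hence the shift j.+1. *)
Theorem theorem3p1 (R : realType) (n : nat) (q : R) (a b c d x theta : R[i])
    (Hn : (1 <= n)%N) (Hq : 0 < q < 1) (Hx : x = ccos theta)
    (Ha : a != 0)
    (Hp : qpochs [:: a * b; a * c; a * d] q%:C n != 0)
    (Hs : qpoch (a * b * c * d) q%:C (2 * n - 1) != 0) :
  \det (\matrix_(i < n, j < n) AWentry x a b c d q%:C i j.+1) =
  AWconst n a b c d q%:C * askey_wilson n theta a b c d q%:C.
Proof.
case: n Hn Hp Hs => // m _ Hp Hs; have [b0|b0] := eqVneq b 0.
  (* For b = 0 every entry vanishes, and so does D_n, because n >= 1 leaves a positive power of b in
     it. *)
  rewrite AWconstE big_ord_recr /= b0 exprS !mul0r mulr0 !mul0r mulr0 mul0r.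
  rewrite (_ : \matrix_(i, j) _ = 0) ?det0 //; apply/matrixP => i j.
  by rewrite !mxE /AWentry oppr0 mul0r mulr0 !mul0r.
case/andP: Hq => q_gt0 q_lt1.
have q0 : q%:C != 0 by rewrite fmorph_eq0 gt_eqF.
have q_gen k : q%:C ^+ k.+1 != 1.
  by rewrite -rmorphXn fmorph_eq1 lt_eqF // exprn_ilt1 // ltW.
have zV : cexp ('i * theta) * cexp (- 'i * theta) = 1.
  by rewrite mulrC mulNr cexpNM.
have z0 : cexp ('i * theta) != 0.
  by apply: contra_eq_neq zV => ->; rewrite mul0r eq_sym oner_eq0.
have zE : cexp (- 'i * theta) = (cexp ('i * theta))^-1.
  by apply: (mulfI z0); rewrite zV mulfV.
have xE : 2 * x = cexp ('i * theta) + (cexp ('i * theta))^-1.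
  by rewrite Hx /ccos zE mulrC divfK.
move: Hp; rewrite /qpochs !big_cons big_nil mulr1 !mulf_eq0 !negb_or.
move=> /and3P[ab_nz ac_nz ad_nz].
rewrite (det_AWentry Ha b0 z0 q0 q_gen xE) //; congr (_ * (_ * _)).
  by rewrite /qpochs !big_cons big_nil mulr1 !mulrA.
apply: eq_bigr => k _.
by rewrite /qpochs !big_cons !big_nil !mulr1 zE subn1 !mulrA.
Qed.
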